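(* Let $X$ be a real Hilbert space, $g\in\Gamma_0(X)$, $h:X\to\mathbb{R}$ convex and differentiable with $L$-Lipschitz gradient, $L\in]0,+\infty[$, and $f=g+h$ with $\operatorname{argmin} f\neq\emptyset$. Let $\Omega\subset X$, $\lambda\in]0,2L^{-1}[$ and $T_\lambda x:=\operatorname{prox}_{\lambda g}(x-\lambda\nabla h(x))$. Consider the property: there exists $\varepsilon_{f,\Omega}\in]0,1[$ such that $$\forall x\in\Omega\cap\operatorname{dom} f,\quad \operatorname{dist}(T_\lambda x,\operatorname{argmin} f)\le\varepsilon_{f,\Omega}\operatorname{dist}(x,\operatorname{argmin} f).\qquad(\star)$$ (i) If $f$ verifies $(\star)$ on $\Omega$, then $f$ is $2$-conditioned on $\Omega$ with $\gamma_{f,\Omega}=\lambda^{-1}(2-\lambda L)(1-\varepsilon_{f,\Omega})^2$. (ii) If $\lambda\in]0,L^{-1}]$ and $f$ is $2$-conditioned on $T_\lambda\Omega$ with constant $\gamma$, then $f$ verifies $(\star)$ on $\Omega$ with $\varepsilon_{f,\Omega}=(1+\lambda\gamma)^{-1/2}$. Consequently, if $\Omega$ is FB-invariant and $\lambda\in]0,L^{-1}]$, then $f$ is $2$-conditioned on $\Omega$ if and only if $f$ verifies $(\star)$ on $\Omega$.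
   Context: $\Gamma_0(X)$ is the set of proper, convex, lower semicontinuous functions $X\to]-\infty,+\infty]$. $\operatorname{prox}_{\lambda g}(x)=\operatorname{argmin}_{u\in X}\{g(u)+\frac1{2\lambda}\|u-x\|^2\}$. $f$ is $2$-conditioned on $\Omega$ with constant $\gamma_{f,\Omega}>0$ if $\frac{\gamma_{f,\Omega}}2\operatorname{dist}(x,\operatorname{argmin} f)^2\le f(x)-\inf f$ for all $x\in\Omega\cap\operatorname{dom} f$. A set $\Omega\subset X$ is FB-invariant if $T_{\lambda'}\Omega\subset\Omega$ for all $\lambda'\in]0,2L^{-1}[$. *)

(* Defs.v *)
From HB Require Import structures.
From mathcomp Require Import all_boot all_order all_algebra.
From mathcomp Require Import sesquilinear.
From mathcomp Require Import all_classical all_reals all_analysis.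

Set Implicit Arguments.
Unset Strict Implicit.
Unset Printing Implicit Defensive.

Import Order.TTheory GRing.Theory Num.Theory.
Import numFieldNormedType.Exports.

Local Open Scope classical_set_scope.
Local Open Scope ring_scope.

Section ExtendedRealFunctions.
Context {R : realType} {X : normedModType R}.
Implicit Types (f g : X -> \bar R) (Omega : set X).
Local Open Scope ereal_scope.

Definition effective_domain f : set X := [set x | f x < +oo].

(* This is the usual argmin only for functions that are not identically +oo. *)
Definition argmin f : set X := [set x | forall y, f x <= f y].

Definition proper_function f :=
  (forall x, f x != -oo) /\ effective_domain f !=set0.

(* The library's convex_function is only for real-valued functions. The
   right-hand side is well defined when f does not take the value -oo. *)
Definition convex_efunction f := forall (x y : X) (t : R),
  (0 <= t <= 1)%R ->
  f (t *: x + (1 - t) *: y)%R <= t%:E * f x + (1 - t)%:E * f y.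

Definition Gamma0 : set (X -> \bar R) :=
  [set f | [/\ proper_function f, convex_efunction f
             & lower_semicontinuous f]].

(* For lambda > 0 and g in Gamma0 the argmin is a singleton, so that get
   returns its only element. *)
Definition prox (lambda : R) g (x : X) : X :=
  get (argmin (fun u => g u + ((2 * lambda)^-1 * `|u - x| ^+ 2)%:E)).

(* edist_inf A x is the infimum of the distances from x to the points of A, with
   value +oo if A is empty. *)
Definition two_conditioned f Omega (gamma : R) := (0 < gamma)%R /\
  forall x, (Omega `&` effective_domain f) x ->
    (gamma / 2)%:E * edist_inf (argmin f) x ^+ 2 <= f x - ereal_inf (range f).

Definition contracts_to_argmin (T : X -> X) f Omega (eps : R) :=
  (0 < eps < 1)%R /\
  forall x, (Omega `&` effective_domain f) x ->
    edist_inf (argmin f) (T x) <= eps%:E * edist_inf (argmin f) x.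

End ExtendedRealFunctions.

Section ForwardBackward.
Context {R : realType} {X : normedModType R} (ip : {dot X for idfun}).
Implicit Types (g : X -> \bar R) (h : X -> R).

(* There is no Hilbert space structure in the library: a real Hilbert space is a
   complete normed module X with an inner product ip : {dot X for idfun} such
   that `|x| ^+ 2 = ip x x. *)

(* If X is complete with norm induced by ip and h is differentiable at x, the
   Riesz representation theorem gives existence and uniqueness. *)
Definition gradient h (x : X) : X :=
  get [set v | forall u, 'd (h : X -> R^o) x u = ip v u].

Definition forward_backward g h (lambda : R) (x : X) : X :=
  prox lambda g (x - lambda *: gradient h x).

Definition FB_invariant g h (L : R) (Omega : set X) :=
  forall lambda, 0 < lambda < 2 / L ->
    forward_backward g h lambda @` Omega `<=` Omega.

End ForwardBackward.

(* Main.v *)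
Require Import Defs.
From mathcomp Require Import all_boot all_order all_algebra.
From mathcomp Require Import sesquilinear ring lra.
From mathcomp Require Import all_classical all_reals all_analysis.
Import Order.TTheory GRing.Theory Num.Theory.
Import numFieldNormedType.Exports.
Local Open Scope classical_set_scope.
Local Open Scope ring_scope.

(** The whole argument rests on one inequality for a forward-backward step
[p = T x], valid for every point [u] ([forward_backward_le]):
[f p + lambda^-1 <x - p, u - p> - L/2 |x - p|^2 <= f u].
It adds up the variational inequality that characterises the proximal point
([prox_variational]), the gradient inequality of the convex function [h]
between [x] and [u] ([convex_gradient_le]), and the quadratic upper bound on [h]
between [x] and [p] given by the Lipschitz gradient ([descent_lemma]).

For [u = x] it says that a step decreases [f] by at least
[(2 - lambda L) / (2 lambda) |x - p|^2] ([sufficient_decrease]). If [T]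
contracts the distance [D] to the minimizers by a factor [eps], then the
triangle inequality [D x <= |x - p| + D p] bounds [(1 - eps) D x] by [|x - p|],
and the decrease becomes the quadratic growth of [f].

For [lambda <= L^-1] and [u = a] a minimizer, expanding the squares gives
[2 lambda (f p - inf f) + |p - a|^2 <= |x - a|^2] ([forward_backward_fejer]).
Growth at the point [p] turns the left-hand side into at least
[(1 + lambda gamma) (D p)^2], and taking the infimum over [a] gives the
contraction. The equivalence follows, since an invariant [Omega] contains
the image of [Omega] under [T].

Two existence facts support this. The proximal point exists because the
sublevel sets of a strongly convex lower semicontinuous function that is
bounded below form a Cauchy filter, whose limit is a minimizer
([uniformly_quasiconvex_argmin]). The gradient exists by the Riesz
representation theorem, which is obtained here from the proximal point of a
linear form ([riesz_representation]). *)

(** * Inner products and squared norms *)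

Section InnerProduct.
Context {R : realType} {X : normedModType R} (ip : {dot X for idfun}).
Hypothesis ip_norm : forall x : X, `|x| ^+ 2 = ip x x.

Lemma ipC x y : ip x y = ip y x.
Proof. by rewrite hermC /= expr0 mul1r. Qed.

Lemma ipDl x y z : ip (x + y) z = ip x z + ip y z.
Proof. exact: linearDl. Qed.

Lemma ipZl (a : R) x y : ip (a *: x) y = a * ip x y.
Proof. by rewrite linearZl_LR. Qed.

Lemma ipBl x y z : ip (x - y) z = ip x z - ip y z.
Proof. exact: linearBl. Qed.

Lemma ipDr x y z : ip x (y + z) = ip x y + ip x z.
Proof. by rewrite ipC ipDl !(ipC x). Qed.

Lemma ipZr (a : R) x y : ip x (a *: y) = a * ip x y.
Proof. by rewrite ipC ipZl (ipC x). Qed.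

Lemma ipBr x y z : ip x (y - z) = ip x y - ip x z.
Proof. by rewrite ipC ipBl !(ipC x). Qed.

(** The subtraction rules precede the addition rules, which also match a
difference and would leave inner products with an opposite. *)
Definition ipE := (ipBl, ipBr, ipDl, ipDr, ipZl, ipZr).

Lemma normD_sqr (x y : X) : `|x + y| ^+ 2 = `|x| ^+ 2 + 2 * ip x y + `|y| ^+ 2.
Proof. by rewrite !ip_norm !ipE (ipC y x); ring. Qed.

Lemma normB_sqr (x y : X) : `|x - y| ^+ 2 = `|x| ^+ 2 - 2 * ip x y + `|y| ^+ 2.
Proof. by rewrite !ip_norm !ipE (ipC y x); ring. Qed.

(** Cauchy-Schwarz, read off from the reverse triangle inequality because the
norm is already known to be a norm. *)
Lemma ip_le_norm (x y : X) : ip x y <= `|x| * `|y|.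
Proof.
have : (`|x| - `|y|) ^+ 2 <= `|x - y| ^+ 2.
  by rewrite -real_normK ?num_real// lerXn2r ?nnegrE// ler_dist_dist.
rewrite normB_sqr; nra.
Qed.

(** The last term is the strong convexity of the squared distance, which makes
minimizing sequences Cauchy. *)
Lemma parallelogram_midpoint (u v z : X) :
  `|2^-1 *: (u + v) - z| ^+ 2 =
  2^-1 * `|u - z| ^+ 2 + 2^-1 * `|v - z| ^+ 2 - 4^-1 * `|u - v| ^+ 2.
Proof.
by rewrite !ip_norm !ipE (ipC v u) (ipC z u) (ipC z v); field.
Qed.

End InnerProduct.

(** * Existence of proximal points *)

Section Minimizer.
Context {R : realType} {X : completeNormedModType R}.
Implicit Types (phi : X -> \bar R).
Local Open Scope ereal_scope.

(** If [u] and [v] have values within [e] of the infimum, their midpoint cannot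
go below the infimum, hence [c * `|u - v| ^+ 2 <= e]: the sublevel sets shrink
to a point. Only upper bounds on the values enter the convexity hypothesis, so
that extended values never have to be combined. *)
Lemma uniformly_quasiconvex_argmin phi (c m0 : R) (x0 : X) :
  (0 < c)%R -> phi x0 < +oo -> (forall u, m0%:E <= phi u) ->
  lower_semicontinuous phi ->
  (forall u v (a : R), phi u <= a%:E -> phi v <= a%:E ->
     phi (2^-1 *: (u + v))%R <= (a - c * `|u - v| ^+ 2)%:E) ->
  argmin phi !=set0.
Proof.
move=> c0 phix0 phim0 lsc_phi midphi.
have inf_le u : ereal_inf (range phi) <= phi u by apply: ereal_inf_lbound; exists u.
have : ereal_inf (range phi) \is a fin_num.
  rewrite fin_real//; apply/andP; split; last exact: le_lt_trans (inf_le x0) phix0.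
  apply: lt_le_trans (ltNyr m0) _; by apply/ereal_infP => _ [u _ <-].
set m := fine (ereal_inf (range phi)) => /fineK mE; rewrite -/m in mE.
have m_le u : m%:E <= phi u by rewrite mE.
pose sub (e : R) := [set u | phi u <= (m + e)%:E].
have sub_le (d e : R) : (d <= e)%R -> sub d `<=` sub e.
  by move=> de u /= /le_trans; apply; rewrite lee_fin lerD2l.
have sub_ne (e : R) : (0 < e)%R -> sub e !=set0.
  move=> e0.
  have [_ [u _ <-] ule] : exists2 y, range phi y & y < (m + e)%:E.
    by apply/ereal_inf_lt; rewrite -mE lte_fin ltrDl.
  by exists u; exact: ltW.
(* Completeness is applied to the filter of these sublevel sets; no minimizing
   sequence has to be chosen. *)
pose F := filter_from [set e : R | (0 < e)%R] sub.
have FF : ProperFilter F.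
  apply: filter_from_proper => //; apply: filter_from_filter; first by exists 1%R => /=.
  move=> d e /= d0 e0; exists (Num.min d e); first by rewrite lt_min d0.
  by move=> u ude; split; apply: sub_le ude; rewrite ge_min lexx ?orbT.
have /cauchy_cvg cvF : cauchy F.
  apply: cauchy_exP => e e0.
  have eta0 : (0 < c * e ^+ 2 / 4)%R by rewrite divr_gt0// mulr_gt0// exprn_gt0.
  have [u uphi] := sub_ne _ eta0.
  exists u, (c * e ^+ 2 / 4)%R => // v vphi.
  rewrite -ball_normE /=.
  have := le_trans (m_le _) (midphi u v _ uphi vphi).
  rewrite lee_fin => mid_le.
  have : (c * `|u - v| ^+ 2 <= c * (e ^+ 2 / 4))%R by lra.
  rewrite ler_pM2l// => uv_le.
  have : (`|u - v| <= e / 2)%R.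
    rewrite -(ler_pXn2r (n := 2)) ?nnegrE//; last by rewrite divr_ge0// ltW.
    by rewrite expr_div_n; apply: le_trans uv_le _; rewrite -natrX.
  lra.
set p := lim F in cvF.
(* If [phi p] exceeded the infimum, lower semicontinuity would keep a
   neighbourhood of [p], hence a whole sublevel set, above some [a > m]. *)
exists p => y; apply: le_trans (m_le y); rewrite leNgt; apply/negP => mp.
have [a ma ap] : exists2 a : R, (m < a)%R & a%:E < phi p.
  case: (phi p) mp => [s| |] //=; rewrite ?lte_fin => ms.
    by exists ((m + s) / 2)%R; rewrite ?lte_fin; lra.
  by exists (m + 1)%R; rewrite ?ltry//; lra.
have [V pV Va] := lsc_phi _ _ ap.
have [e /= e0 eV] := cvF _ pV.
have min0 : (0 < Num.min e (a - m))%R by rewrite lt_min e0 subr_gt0.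
have [u uphi] := sub_ne _ min0.
have /eV/Va : sub e u by apply: sub_le uphi; rewrite ge_min lexx.
apply/negP; rewrite -leNgt; apply: le_trans uphi _.
by rewrite lee_fin -lerBrDl ge_min lexx orbT.
Qed.

Lemma Gamma0_fin_num (g : X -> \bar R) u : Gamma0 g -> g u < +oo -> g u \is a fin_num.
Proof. by move=> [[gNy _] _ _] gu; rewrite fin_numE gNy lt_eqF. Qed.

(** A lower bound with linear growth, obtained without separating hyperplanes:
lower semicontinuity bounds [g] from below on a ball around a point [x0] of the
domain, and convexity along the segment from [x0] to [u] carries the bound
outwards. *)
Lemma Gamma0_lower_bound (g : X -> \bar R) : Gamma0 g ->
  exists (x0 : X) (a b : R), [/\ g x0 < +oo, (0 < b)%R
    & forall u, (a - b * `|u - x0|)%:E <= g u].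
Proof.
move=> G; have [[gNy [x0 gx0]] cvx_g lsc_g] := G.
set r := fine (g x0).
have rE : g x0 = r%:E by rewrite /r fineK//; exact: Gamma0_fin_num.
have r1 : (r - 1)%:E < g x0 by rewrite rE lte_fin; lra.
have [V /nbhs_ballP [d /= d0 dV] Vg] := lsc_g _ _ r1.
exists x0, (r - 1)%R, (2 / d)%R; split=> //; first by rewrite divr_gt0.
move=> u; have [ud|du] := ltP `|u - x0|%R d.
  apply: le_trans (ltW (Vg u _)); last first.
    by apply: dV; rewrite -ball_normE /= distrC.
  rewrite lee_fin gerBl mulr_ge0// divr_ge0// ltW//.
set rho := `|u - x0|%R; rewrite -/rho in du.
have rho0 : (0 < rho)%R by lra.
(* The point at distance [d / 2] from [x0] towards [u] lies in the ball. *)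
pose t := (d / (2 * rho))%R.
have t0 : (0 < t)%R by rewrite divr_gt0// mulr_gt0.
have trho : (t * rho = d / 2)%R by rewrite /t; field; rewrite gt_eqF.
have t1 : (t <= 1)%R by rewrite ler_pdivrMr ?mulr_gt0//; lra.
have /Vg w_gt : V (t *: u + (1 - t) *: x0)%R.
  apply: dV; rewrite -ball_normE /= distrC.
  have -> : (t *: u + (1 - t) *: x0 - x0 = t *: (u - x0))%R.
    by rewrite scalerBl scale1r scalerBr -addrA (addrAC x0) subrr add0r.
  by rewrite normrZ gtr0_norm// -/rho trho; lra.
have := lt_le_trans w_gt (cvx_g u x0 t _); rewrite (ltW t0) t1 => /(_ isT).
rewrite rE; have := gNy u; case: (g u) => [s _| _ _|//]; last by rewrite leey.
rewrite -!EFinM -EFinD lte_fin lee_fin => ts.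
rewrite -(ler_pM2l t0).
have -> : (t * (r - 1 - 2 / d * rho) = t * r - t - 2 / d * (t * rho))%R by ring.
rewrite trho; have -> : (2 / d * (d / 2) = 1)%R by field; rewrite gt_eqF.
nra.
Qed.

Variable ip : {dot X for idfun}.
Hypothesis ip_norm : forall x : X, (`|x| ^+ 2 = ip x x)%R.

Lemma prox_exists (g : X -> \bar R) (c : R) (z : X) : Gamma0 g -> (0 < c)%R ->
  argmin (fun u => g u + (c * `|u - z| ^+ 2)%:E) !=set0.
Proof.
move=> G c0; have [[gNy _] cvx_g lsc_g] := G.
have [x0 [a [b [gx0 b0 g_ge]]]] := Gamma0_lower_bound _ G.
apply: (@uniformly_quasiconvex_argmin _ (c / 4)%R
  (a - b * `|z - x0| - b ^+ 2 / (4 * c))%R x0).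
- by rewrite divr_gt0.
- by rewrite lte_add_pinfty// ltry.
  (* The minimum over [s >= 0] of [c * s ^+ 2 - b * s] is [- b ^+ 2 / (4 * c)]. *)
- move=> u; apply: le_trans (leeD2r _ (g_ge u)); rewrite -EFinD lee_fin.
  have := ler_distD z u x0; set s := `|u - z|%R => tri.
  have : (0 <= c * (s - b / (2 * c)) ^+ 2)%R by rewrite mulr_ge0 ?sqr_ge0// ltW.
  have -> : (c * (s - b / (2 * c)) ^+ 2 = c * s ^+ 2 - b * s + b ^+ 2 / (4 * c))%R.
    by field; rewrite gt_eqF.
  nra.
- move=> u k; set q := (fun w : X => c * `|w - z| ^+ 2)%R => kgq.
  have kg : (k - q u)%:E < g u by rewrite EFinB lteBlDr.
  have [k' kk' k'g] : exists2 k' : R, (k - q u < k')%R & k'%:E < g u.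
    case: (g u) kg => [s| |] //=; rewrite ?lte_fin => ms.
      by exists ((k - q u + s) / 2)%R; rewrite ?lte_fin; lra.
    by exists (k - q u + 1)%R; rewrite ?ltry//; lra.
  have [V uV Vg] := lsc_g _ _ k'g.
  have q_cont : {for u, continuous q}.
    apply: cvgMr; apply: (@cvg_comp _ _ _ _ (fun r : R => r ^+ 2)%R); last exact: exprn_continuous.
    by apply: cvg_norm; apply: cvgB => //; exact: cvg_cst.
  exists (V `&` [set w | (k - k' < q w)%R]).
    by apply: filterI => //; apply: (cvgr_gt (q u) q_cont); rewrite ltrBlDr -ltrBlDl.
  move=> w [/Vg gw /= qw]; apply: le_lt_trans (lte_leD _ gw (lexx _)) => //.
  by rewrite -EFinD lee_fin -[(c * _)%R]/(q w); lra.
- move=> u v k ku kv.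
  have fg w : g w + (c * `|w - z| ^+ 2)%:E <= k%:E -> g w \is a fin_num.
    move=> wk; apply: Gamma0_fin_num => //.
    by case: (g w) wk => // r _; rewrite ltry.
  have h2 : (0 <= (2^-1 : R) <= 1)%R by apply/andP; split; lra.
  have := cvx_g u v 2^-1%R h2.
  have -> : (1 - 2^-1 = 2^-1 :> R)%R by field.
  rewrite -scalerDr.
  have /fineK gu := fg _ ku; have /fineK gv := fg _ kv.
  move: ku kv; rewrite -gu -gv -!EFinM -!EFinD !lee_fin => ku kv.
  move=> mid; apply: le_trans (leeD2r _ mid) _.
  rewrite -EFinD lee_fin (parallelogram_midpoint _ ip_norm); lra.
Qed.

End Minimizer.

(** * The variational inequality and the Riesz representation *)

Section ProxVariational.
Context {R : realType} {X : completeNormedModType R} (ip : {dot X for idfun}).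
Hypothesis ip_norm : forall x : X, `|x| ^+ 2 = ip x x.

Lemma le0_small_slope (a b : R) : 0 <= b ->
  (forall t : R, 0 < t -> t <= 1 -> a <= t * b) -> a <= 0.
Proof.
move=> b0 ab; apply/ler_addgt0Pr => e e0; rewrite add0r.
have b1 : 0 < b + 1 by lra.
have t0 : 0 < Num.min 1 (e / (b + 1)) by rewrite lt_min ltr01 divr_gt0.
apply: le_trans (ab _ t0 _) _; first by rewrite ge_min lexx.
apply: (@le_trans _ _ (e / (b + 1) * b)).
  by apply: ler_wpM2r => //; rewrite ge_min lexx orbT.
by rewrite mulrAC ler_pdivrMr//; nra.
Qed.

(** Minimality of [p] is tested against the points [t *: u + (1 - t) *: p]:
convexity of [g] and the expansion of the square leave an inequality in [t]
whose first-order term must have the right sign. *)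
Lemma prox_variational (g : X -> \bar R) (lambda : R) (z p : X) :
  Gamma0 g -> 0 < lambda ->
  argmin (fun u => g u + ((2 * lambda)^-1 * `|u - z| ^+ 2)%:E)%E p ->
  g p \is a fin_num /\
  forall u, (g p + (lambda^-1 * ip (z - p) (u - p))%:E <= g u)%E.
Proof.
move=> G l0 pmin; have [[gNy [x gx]] cvx_g _] := G.
have gp : g p \is a fin_num.
  apply: Gamma0_fin_num => //; have := pmin x.
  have /fineK <- := Gamma0_fin_num _ _ G gx.
  by case: (g p) => // r _; rewrite ltry.
split=> // u; have := gNy u.
case gu : (g u) => [s| |] // _; last by rewrite leey.
rewrite -(fineK gp); set r := fine (g p).
rewrite -EFinD lee_fin -subr_le0.
apply: (@le0_small_slope _ ((2 * lambda)^-1 * `|u - p| ^+ 2)).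
  by rewrite mulr_ge0 ?invr_ge0 ?mulr_ge0// ltW.
move=> t t0 t1.
have t01 : 0 <= t <= 1 by rewrite t1 ltW.
have := le_trans (pmin (t *: u + (1 - t) *: p)) (leeD2r _ (cvx_g u p t t01)).
rewrite gu -(fineK gp) -/r -!EFinM -!EFinD lee_fin.
have -> : t *: u + (1 - t) *: p - z = (p - z) + t *: (u - p).
  by rewrite scalerBl scale1r scalerBr addrCA addrAC.
rewrite (normD_sqr _ ip_norm (p - z)) normrZ exprMn gtr0_norm// (ipZr ip).
have -> : ip (z - p) (u - p) = - ip (p - z) (u - p).
  by rewrite -opprB -scaleN1r (ipZl ip) mulN1r.
set q := ip _ _; set n1 := `|p - z| ^+ 2; set n2 := `|u - p| ^+ 2.
have -> : lambda^-1 = 2 * (2 * lambda)^-1 by field; rewrite gt_eqF.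
set k := (2 * lambda)^-1 => H.
rewrite -(ler_pM2l t0); nra.
Qed.

(** The minimizer [v] of [- l u + `|u| ^+ 2 / 2] represents [l]: its variational
inequality compares the linear forms [l] and [ip v], and a linear form that is
below another one is equal to it. *)
Lemma riesz_representation (l : {linear X -> R^o}) : continuous l ->
  exists v : X, forall u, l u = ip v u.
Proof.
move=> cl; pose g (u : X) : \bar R := (- (l u : R))%:E.
have G : Gamma0 g.
  split; first by split=> [x|]; [| exists 0; rewrite /effective_domain /= ltry].
    move=> x y t _; rewrite /g -!EFinM -EFinD lee_fin linearD !linearZ /=.
    by rewrite /GRing.scale /=; lra.
  move=> x a; rewrite /g lte_fin => ax.
  have cNl : {for x, continuous (fun u => - (l u : R))}.
    by apply: cvgN; exact: cl.
  by exists [set u | a < - (l u : R)]; [exact: (cvgr_gt _ cNl)|].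
have half0 : 0 < (2 * 1 : R)^-1 by rewrite invr_gt0; lra.
have [v vmin] := prox_exists _ ip_norm g _ 0 G half0.
have [_ v_var] := prox_variational _ _ _ _ G ltr01 vmin.
have l_le w : (l w : R) <= ip v w.
  have := v_var (v + w).
  rewrite /g -EFinD lee_fin invr1 mul1r sub0r (addrC v) addrK linearD.
  have -> : ip (- v) w = - ip v w by rewrite -scaleN1r (ipZl ip) mulN1r.
  by rewrite /=; lra.
exists v => u; apply/eqP; rewrite eq_le l_le /=.
have := l_le (- u); rewrite linearN /=.
have -> : ip v (- u) = - ip v u by rewrite -scaleN1r (ipZr ip) mulN1r.
by rewrite lerN2.
Qed.

Lemma gradientP (h : X -> R) x u : differentiable (h : X -> R^o) x ->
  'd (h : X -> R^o) x u = ip (gradient ip h x) u.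
Proof.
move=> dh.
have [v vP] := riesz_representation _ (diff_continuous dh).
exact: (@getPex _ [set v | forall u, 'd (h : X -> R^o) x u = ip v u]
  (ex_intro _ v vP)).
Qed.

End ProxVariational.

(** * Convex functions with a Lipschitz gradient *)

Section SmoothConvex.
Context {R : realType} {X : completeNormedModType R} (ip : {dot X for idfun}).
Hypothesis ip_norm : forall x : X, `|x| ^+ 2 = ip x x.
Variable h : X -> R.
Hypothesis h_diff : forall x : X, differentiable (h : X -> R^o) x.

(** The difference quotients of the restriction of [h] to the line are literally
those of the directional derivative of [h] along [d]. *)
Lemma is_derive_line (x d : X) (t : R) :
  is_derive t (1 : R) (fun s : R => h (x + s *: d)) (ip (gradient ip h (x + t *: d)) d).
Proof.
pose f := h : X -> R^o.
have E : (fun s : R => s^-1 *: (((fun s : R => h (x + s *: d)) \o shift t) (s *: 1)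
           - h (x + t *: d))) =
         (fun s : R => s^-1 *: ((f \o shift (x + t *: d)) (s *: d) - f (x + t *: d))).
  apply/funext => s /=; rewrite /f; congr (_ *: (h _ - _)).
  by rewrite scaler1 scalerDl addrCA.
have dh := diff_derivable (v := d) (h_diff (x + t *: d)).
split; first by rewrite /derivable E.
by rewrite -(gradientP _ ip_norm _ _ _ (h_diff _)) -deriveE// /derive E.
Qed.

Lemma convex_functionP (x y : X) (t : R) : @convex_function R X [set: X] h ->
  0 <= t -> t <= 1 -> h (t *: x + (1 - t) *: y) <= t * h x + (1 - t) * h y.
Proof.
move=> cvx t0 t1.
by have := cvx (Itv01 t0 t1) x y (mem_set I) (mem_set I); rewrite convRE.
Qed.

(** By convexity the difference quotients of [h] from [x] towards [y] are at most
[h y - h x], and so is their limit. *)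
Lemma convex_gradient_le (x y : X) : @convex_function R X [set: X] h ->
  h x + ip (gradient ip h x) (y - x) <= h y.
Proof.
move=> cvx; rewrite addrC -lerBrDr -gradientP// -deriveE//.
apply: (@cvgr_to_le _ (0 : R)^'+ _ _
  (fun s : R => s^-1 * (h (s *: (y - x) + x) - h x))).
  by apply: cvg_dnbhs_at_right; exact: diff_derivable.
near=> s.
have s0 : 0 < s by [].
have s1 : s <= 1 by near: s; apply: nbhs_right_le.
rewrite mulrC ler_pdivrMr//.
have := convex_functionP y x s cvx (ltW s0) s1.
have -> : s *: y + (1 - s) *: x = s *: (y - x) + x.
  by rewrite scalerBl scale1r scalerBr addrCA addrC.
lra.
Unshelve. all: by end_near. Qed.

(** The remainder [psi], which is [h] on the segment minus its quadratic upper
model, has a nonpositive derivative; the mean value theorem on [psi] gives the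
sharp constant [L / 2], which it would not do on [h] directly. *)
Lemma descent_lemma (L : R) (x y : X) : 0 < L -> L.-lipschitz (gradient ip h) ->
  h y <= h x + ip (gradient ip h x) (y - x) + L / 2 * `|y - x| ^+ 2.
Proof.
move=> L0 lip; set d := y - x.
set A := ip (gradient ip h x) d; set B := L / 2 * `|d| ^+ 2.
pose psi (t : R) := h (x + t *: d) - (t * A + B * t ^+ 2).
pose dpsi (t : R) := ip (gradient ip h (x + t *: d)) d - (A + B * (2 * t)).
have psiP (t : R) : is_derive t (1 : R) psi (dpsi t).
  have := is_derive_line x d t => ?.
  have ? : is_derive t (1 : R) (fun t : R => t * A + B * t ^+ 2) (A + B * (2 * t)).
    apply: is_derive_eq; rewrite /GRing.scale /=; ring.
  exact: is_deriveB.
have psi_cont : {within `[0, 1], continuous psi}.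
  by apply: derivable_within_continuous => t _; apply: ex_derive.
have [t] := MVT_segment (ler01 : (0 : R) <= 1) (fun t _ => psiP t) psi_cont.
rewrite in_itv /= => /andP[t0 t1].
rewrite subr0 mulr1 /psi scale1r scale0r addr0 mul1r mul0r expr1n expr0n /= mulr1 mulr0.
have -> : x + d = y by rewrite /d addrC subrK.
move=> E.
have : dpsi t <= 0.
  rewrite /dpsi.
  have -> : B * (2 * t) = L * `|t *: d| * `|d|.
    by rewrite normrZ ger0_norm// /B; field.
  rewrite subr_le0 -lerBlDl /A -(ipBl ip).
  apply: le_trans (ip_le_norm _ ip_norm _ _) _; apply: ler_wpM2r => //.
  have := lip (x + t *: d, x) => /=; rewrite (addrC x) addrK; apply.
  by split.
by rewrite -E; lra.
Qed.

End SmoothConvex.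

(** * The distance to a nonempty set *)

Section Distance.
Context {R : realType} {X : normedModType R}.
Variables (A : set X) (a0 : X).
Hypothesis Aa0 : A a0.
Local Notation D x := (fine (edist_inf A x)).

Lemma edist_norm (x y : X) : edist (x, y) = `|x - y|%:E.
Proof.
apply/eqP; rewrite eq_le; apply/andP; split.
  apply/lee_addgt0Pr => e e0; rewrite -EFinD; apply: edist_fin => /=.
    by rewrite ltr_wpDl.
  by rewrite -ball_normE /= ltrDl.
by apply/ereal_infP => _ [r [_ +] <-]; rewrite -ball_normE /= lee_fin => /ltW.
Qed.

Lemma edist_inf_fin_num (x : X) : edist_inf A x \is a fin_num.
Proof.
rewrite ge0_fin_numE ?edist_inf_ge0//; apply: le_lt_trans (ltry `|x - a0|).
by rewrite -edist_norm; apply: ereal_inf_lbound; exists a0.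
Qed.

Lemma edist_infE (x : X) : edist_inf A x = (D x)%:E.
Proof. by rewrite fineK// edist_inf_fin_num. Qed.

Lemma dist_ge0 (x : X) : 0 <= D x.
Proof. by rewrite fine_ge0// edist_inf_ge0. Qed.

Lemma dist_le_norm (x a : X) : A a -> D x <= `|x - a|.
Proof.
move=> Aa; rewrite -lee_fin -edist_infE -edist_norm.
by apply: ereal_inf_lbound; exists a.
Qed.

Lemma le_dist (x : X) (r : R) : (forall a, A a -> r <= `|x - a|) -> r <= D x.
Proof.
move=> rA; rewrite -lee_fin -edist_infE; apply/ereal_infP => _ [a Aa <-].
by rewrite edist_norm lee_fin rA.
Qed.

Lemma dist_triangle (x y : X) : D x <= `|x - y| + D y.
Proof. by rewrite -lee_fin EFinD -!edist_infE -edist_norm edist_inf_triangle. Qed.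

End Distance.

(** * One forward-backward step *)

Section ForwardBackwardStep.
Context {R : realType} {X : completeNormedModType R} (ip : {dot X for idfun}).
Hypothesis ip_norm : forall x : X, `|x| ^+ 2 = ip x x.
Variables (g : X -> \bar R) (h : X -> R) (L lambda : R).
Hypothesis g_Gamma0 : Gamma0 g.
Hypothesis h_convex : @convex_function R X [set: X] h.
Hypothesis h_diff : forall x : X, differentiable (h : X -> R^o) x.
Hypothesis L_gt0 : 0 < L.
Hypothesis h_lip : L.-lipschitz (gradient ip h).
Hypothesis lambda_gt0 : 0 < lambda.

Let f (x : X) : \bar R := (g x + (h x)%:E)%E.
Let T := forward_backward ip g h lambda.

(** The sum of the three inequalities for [g] between [p] and [u], and for [h]
between [x] and [u] and between [x] and [p]. The terms in the gradient cancel
because [u - p = (u - x) - (p - x)]. *)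
Lemma forward_backward_le (x u : X) :
  (f (T x) + (lambda^-1 * ip (x - T x) (u - T x) - L / 2 * `|x - T x| ^+ 2)%:E
   <= f u)%E.
Proof.
have [[gNy _] _ _] := g_Gamma0.
have c0 : 0 < (2 * lambda)^-1 by rewrite invr_gt0 mulr_gt0.
have /getPex := prox_exists _ ip_norm g _ (x - lambda *: gradient ip h x) g_Gamma0 c0.
rewrite -/(prox _ _ _) -/(forward_backward _ _ _ _ _) -/T => /prox_variational.
move=> /(_ ip ip_norm g_Gamma0 lambda_gt0) [gp /(_ u)].
rewrite /f; set p := T x in gp *; rewrite -(fineK gp).
have := gNy u; case: (g u) => [s| |] // _; last by move=> _; exact: leey.
rewrite -!EFinD !lee_fin.
have -> : lambda^-1 * ip (x - lambda *: gradient ip h x - p) (u - p) =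
    lambda^-1 * ip (x - p) (u - p) - ip (gradient ip h x) (u - p).
  by rewrite addrAC (ipBl ip _ (lambda *: _)) (ipZl ip); field; rewrite gt_eqF.
have -> : u - p = (u - x) - (p - x) by rewrite opprB addrA subrK.
rewrite (ipBr ip (gradient ip h x)).
have := convex_gradient_le _ ip_norm _ h_diff x u h_convex.
have := descent_lemma _ ip_norm _ h_diff L x p L_gt0 h_lip.
rewrite (distrC p); lra.
Qed.

Lemma objective_neqNy (x : X) : f x != -oo%E.
Proof. by have [[/(_ x)]] := g_Gamma0; rewrite /f; case: (g x). Qed.

Lemma forward_backward_dom (x : X) : (f (T x) < +oo)%E.
Proof.
have [[_ [y gy]] _ _] := g_Gamma0.
have fy : (f y < +oo)%E by rewrite /f lte_add_pinfty// ltry.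
by have := le_lt_trans (forward_backward_le x y) fy; case: (f (T x)) => // r _; rewrite ltry.
Qed.

Lemma sufficient_decrease (x : X) :
  (f (T x) + ((2 - lambda * L) / (2 * lambda) * `|x - T x| ^+ 2)%:E <= f x)%E.
Proof.
apply: le_trans (forward_backward_le x x); rewrite -ip_norm leeD2l// lee_fin.
by rewrite le_eqVlt; apply/orP; left; apply/eqP; field; rewrite gt_eqF.
Qed.

(** The polarization identity for the triangle [x], [T x], [u] turns the inner
product into squared distances; [lambda <= L^-1] is what absorbs the remaining
term in [`|x - T x| ^+ 2]. *)
Lemma forward_backward_fejer (x u : X) : lambda <= L^-1 ->
  (f (T x) + ((2 * lambda)^-1 * (`|T x - u| ^+ 2 - `|x - u| ^+ 2))%:E <= f u)%E.
Proof.
move=> lL; apply: le_trans (forward_backward_le x u); rewrite leeD2l// lee_fin.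
set p := T x.
have -> : `|x - u| ^+ 2 = `|x - p| ^+ 2 - 2 * ip (x - p) (u - p) + `|p - u| ^+ 2.
  have -> : x - u = (x - p) - (u - p) by rewrite opprB addrA subrK.
  by rewrite (normB_sqr _ ip_norm) (distrC u).
have lL1 : L <= lambda^-1 by rewrite -[L]invrK lef_pV2// posrE invr_gt0.
have -> : (2 * lambda)^-1 = lambda^-1 / 2 by field; rewrite gt_eqF.
have := sqr_ge0 `|x - p|; nra.
Qed.

(** * Conditioning and contraction *)

Section Conditioning.
Variables (Omega : set X) (a0 : X).
Hypothesis argmin_a0 : argmin f a0.

Let m : R := fine (f a0).

Lemma argmin_value (a : X) : argmin f a -> f a = m%:E.
Proof.
move=> fa; have -> : f a = f a0 by apply: le_anti; rewrite (fa a0) (argmin_a0 a).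
rewrite fineK// fin_numE objective_neqNy /= lt_eqF//.
exact: le_lt_trans (argmin_a0 _) (forward_backward_dom a0).
Qed.

Lemma ereal_inf_objective : ereal_inf (range f) = m%:E.
Proof.
rewrite -(argmin_value a0)//; apply/eqP; rewrite eq_le; apply/andP; split.
  by apply: ereal_inf_lbound; exists a0.
by apply/ereal_infP => _ [y _ <-]; exact: argmin_a0.
Qed.

(** All the quantities involved are finite on the domain of [f], so that the
conditioning and, below, the contraction can be handled as real inequalities. *)
Lemma two_conditionedP (C : set X) (gamma : R) : two_conditioned f C gamma <->
  0 < gamma /\ forall x, C x -> (f x < +oo)%E ->
    gamma / 2 * fine (edist_inf (argmin f) x) ^+ 2 <= fine (f x) - m.
Proof.
have E x : (f x < +oo)%E -> f x = (fine (f x))%:E.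
  by move=> fx; rewrite fineK// fin_numE objective_neqNy lt_eqF.
split=> -[gamma0 H]; split=> // x.
  move=> Cx fx; have := H x (conj Cx fx).
  by rewrite ereal_inf_objective (E _ fx) (edist_infE _ _ argmin_a0) -EFin_expe -EFinM -EFinB lee_fin.
move=> [Cx fx]; have := H x Cx fx.
by rewrite ereal_inf_objective {2}(E _ fx) (edist_infE _ _ argmin_a0) -EFin_expe -EFinM -EFinB lee_fin.
Qed.

Lemma contracts_to_argminP (eps : R) : contracts_to_argmin T f Omega eps <->
  0 < eps < 1 /\ forall x, Omega x -> (f x < +oo)%E ->
    fine (edist_inf (argmin f) (T x)) <= eps * fine (edist_inf (argmin f) x).
Proof.
split=> -[eps01 H]; split=> // x.
  move=> Ox fx; have := H x (conj Ox fx).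
  by rewrite (edist_infE _ _ argmin_a0 x) (edist_infE _ _ argmin_a0 (T x)) -EFinM lee_fin.
by move=> [Ox fx]; rewrite (edist_infE _ _ argmin_a0 x) (edist_infE _ _ argmin_a0 (T x)) -EFinM lee_fin; exact: H.
Qed.

Lemma contraction_two_conditioned (eps : R) : lambda < 2 / L ->
  contracts_to_argmin T f Omega eps ->
  two_conditioned f Omega (lambda^-1 * (2 - lambda * L) * (1 - eps) ^+ 2).
Proof.
move=> lL /contracts_to_argminP [/andP[eps0 eps1] H].
have lL2 : 0 < 2 - lambda * L by rewrite subr_gt0 -ltr_pdivlMr.
apply/two_conditionedP; split.
  by rewrite mulr_gt0 ?exprn_gt0 ?subr_gt0// mulr_gt0 ?invr_gt0// subr_gt0 -ltr_pdivlMr.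
move=> x Ox fx; have {H} := H x Ox fx.
have := dist_triangle _ _ argmin_a0 x (T x).
have := dist_ge0 (argmin f) x.
set Dx := fine (edist_inf _ x); set Dp := fine (edist_inf _ _) => Dx0 tri contr.
have step : ((1 - eps) * Dx) ^+ 2 <= `|x - T x| ^+ 2.
  have e0 : 0 <= 1 - eps by lra.
  by rewrite lerXn2r ?nnegrE ?mulr_ge0//; nra.
have := sufficient_decrease x; have := argmin_a0 (T x).
have := forward_backward_dom x; have := objective_neqNy (T x).
rewrite (argmin_value a0)//; case: (f (T x)) => [r| |] // _ _.
have := objective_neqNy x; case: (f x) fx => [s| |] // _ _.
rewrite -EFinD !lee_fin /= => mr rs.
have k0 : 0 < (2 - lambda * L) / (2 * lambda) by rewrite divr_gt0 ?mulr_gt0.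
have := ler_wpM2l (ltW k0) step.
have -> : lambda^-1 * (2 - lambda * L) * (1 - eps) ^+ 2 / 2 * Dx ^+ 2 =
  (2 - lambda * L) / (2 * lambda) * ((1 - eps) * Dx) ^+ 2 by field; rewrite gt_eqF.
lra.
Qed.

Lemma two_conditioned_contraction (gamma : R) : lambda <= L^-1 ->
  two_conditioned f (T @` Omega) gamma ->
  contracts_to_argmin T f Omega ((1 + lambda * gamma) `^ (- 2^-1)).
Proof.
move=> lL /two_conditionedP [gamma0 H].
have lg0 : 0 < lambda * gamma by rewrite mulr_gt0.
have a1 : 1 < 1 + lambda * gamma by lra.
have a0' : 0 <= 1 + lambda * gamma by lra.
set s := Num.sqrt (1 + lambda * gamma).
have s2 : s ^+ 2 = 1 + lambda * gamma by rewrite sqr_sqrtr.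
have s0 : 0 <= s by rewrite sqrtr_ge0.
have s1 : 1 < s by nra.
rewrite powRN powR12_sqrt// -/s.
apply/contracts_to_argminP; split.
  by rewrite invr_gt0 invf_lt1//; lra.
move=> x Ox fx; have s_gt0 : 0 < s by lra.
rewrite ler_pdivlMl//.
apply: (le_dist _ _ argmin_a0) => a fa.
rewrite -(ler_pXn2r (n := 2)) ?nnegrE ?mulr_ge0 ?dist_ge0// exprMn s2.
have := dist_le_norm _ _ argmin_a0 (T x) _ fa.
have := H (T x) (ex_intro2 _ _ x Ox erefl) (forward_backward_dom x).
have := forward_backward_fejer x a lL; rewrite (argmin_value _ fa).
have := forward_backward_dom x; have := objective_neqNy (T x).
have := dist_ge0 (argmin f) (T x).
set Dp := fine (edist_inf _ _).
case: (f (T x)) => [r| |] // Dp0 _ _; rewrite -EFinD lee_fin /= => fej cond Da.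
have Da2 : Dp ^+ 2 <= `|T x - a| ^+ 2 by rewrite lerXn2r ?nnegrE.
move: fej; set Na := `|T x - a| ^+ 2; set Nx := `|x - a| ^+ 2 => fej.
have : 2 * lambda * (r - m) + Na <= Nx.
  have : 0 <= 2 * lambda * (m - (r + (2 * lambda)^-1 * (Na - Nx))).
    by rewrite mulr_ge0 ?mulr_ge0 ?subr_ge0// ltW.
  have -> : 2 * lambda * (m - (r + (2 * lambda)^-1 * (Na - Nx))) =
    2 * lambda * (m - r) - (Na - Nx) by field; rewrite gt_eqF.
  lra.
have := ler_wpM2l (ltW lambda_gt0) cond.
rewrite -/Na in Da2; lra.
Qed.

End Conditioning.

End ForwardBackwardStep.

Theorem proposition4p19 (R : realType) (X : completeNormedModType R)
    (ip : {dot X for idfun}) (ip_norm : forall x : X, `|x| ^+ 2 = ip x x)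
    (g : X -> \bar R) (g_Gamma0 : Gamma0 g)
    (h : X -> R) (h_convex : @convex_function R X [set: X] h)
    (h_diff : forall x : X, differentiable (h : X -> R^o) x)
    (L : R) (L_gt0 : 0 < L) (h_lip : L.-lipschitz (gradient ip h)) :
  let f := fun x : X => (g x + (h x)%:E)%E in
  argmin f !=set0 ->
  forall (Omega : set X) (lambda : R), 0 < lambda < 2 / L ->
  let T := forward_backward ip g h lambda in
  [/\ forall eps : R, contracts_to_argmin T f Omega eps ->
        two_conditioned f Omega
          (lambda^-1 * (2 - lambda * L) * (1 - eps) ^+ 2),
      lambda <= L^-1 -> forall gamma : R,
        two_conditioned f (T @` Omega) gamma ->
        contracts_to_argmin T f Omega ((1 + lambda * gamma) `^ (- 2^-1)) &
      FB_invariant ip g h L Omega -> lambda <= L^-1 ->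
        ((exists gamma : R, two_conditioned f Omega gamma) <->
         (exists eps : R, contracts_to_argmin T f Omega eps))].
Proof.
move=> f [a0 fa0] Omega lambda lambda_itv T.
have /andP[lambda_gt0 lambda_lt] := lambda_itv.
have cond_of_contr eps : contracts_to_argmin T f Omega eps -> _ :=
  @contraction_two_conditioned _ _ _ ip_norm _ _ _ _ g_Gamma0 h_convex h_diff
    L_gt0 h_lip lambda_gt0 _ _ fa0 eps lambda_lt.
have contr_of_cond lambda_le gamma : two_conditioned f (T @` Omega) gamma -> _ :=
  @two_conditioned_contraction _ _ _ ip_norm _ _ _ _ g_Gamma0 h_convex h_diff
    L_gt0 h_lip lambda_gt0 _ _ fa0 gamma lambda_le.
split=> // invariant lambda_le; split=> [[gamma [gamma0 cond]]|[eps contr]].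
  eexists; apply: (contr_of_cond lambda_le gamma); split=> // y [TOy fy].
  by apply: cond; split=> //; exact: (invariant lambda).
by eexists; exact: cond_of_contr contr.
Qed.
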